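(* Let $R=\bigoplus_{n=0}^{\infty}R_n$ be a non-negatively graded ring, and let $\mathcal T=\{f_\alpha\mid\alpha\in\Omega\}$ be a sequence of homogeneous elements of positive degree in $R$ indexed by a well-ordered set $\Omega$. Then $\mathcal T$ is a regular sequence on $R$ if and only if $\mathcal T$ satisfies the FR-condition. In particular, any permutation of a homogeneous regular sequence is again a regular sequence; that is, if $\{f_\alpha\mid\alpha\in\Omega\}$ (homogeneous elements of positive degree) is a regular sequence on $R$ and $\sigma:\Omega'\to\Omega$ is a bijection from another well-ordered set $\Omega'$, then $\{f_{\sigma(\alpha')}\mid\alpha'\in\Omega'\}$ is a regular sequence on $R$.
   Context: Rings are commutative with unit. Let $\Omega$ be a well-ordered set and $\{f_\alpha\in R\mid\alpha\in\Omega\}$ a family of elements of a ring $R$. It is a regular sequence on $R$ if $R/(f_\alpha\mid\alpha\in\Omega)R\neq 0$ and, for every $\alpha\in\Omega$, $f_\alpha$ is a non-zero divisor on $R/(f_\beta\mid\beta<\alpha)R$. It is a homogeneous regular sequence if $R$ is graded and moreover all $f_\alpha$ are homogeneous. It satisfies the FR-condition (finite regularity condition) if every finite subsequence $f_{\alpha_1},\ldots,f_{\alpha_r}$ with $\alpha_1<\alpha_2<\cdots<\alpha_r$ in $\Omega$ (including the empty one) is a regular sequence on $R$ in this order. *)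

(* Defs.v *)
From HB Require Import structures.
From mathcomp Require Import all_boot all_order all_algebra.
From mathcomp Require Import boolp classical_sets wochoice.

Set Implicit Arguments.
Unset Strict Implicit.
Unset Printing Implicit Defensive.

Import Order.TTheory GRing.Theory.

Local Open Scope classical_set_scope.
Local Open Scope ring_scope.
Local Open Scope quotient_scope.

Section GeneratedIdeal.
Context {R : comPzRingType}.
Implicit Type S : set R.

Definition genideal S : {pred R} := fun x =>
  `[< exists s : seq (R * R),
        (forall p, p \in s -> S p.2) /\ x = \sum_(p <- s) p.1 * p.2 >].

Lemma genidealP S x : reflect
  (exists s : seq (R * R),
     (forall p, p \in s -> S p.2) /\ x = \sum_(p <- s) p.1 * p.2)
  (x \in genideal S).
Proof. exact: asboolP. Qed.

Lemma genideal_zmod_closed S : zmod_closed (genideal S).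
Proof.
split=> [|x y /genidealP[s [Ss ->]] /genidealP[t [St ->]]]; apply/genidealP.
  by exists [::]; split=> //; rewrite big_nil.
exists (s ++ [seq (- p.1, p.2) | p <- t]); split=> [p|].
  by rewrite mem_cat => /orP[/Ss //|/mapP[q /St Sq ->]].
rewrite big_cat big_map /= -sumrN; congr (_ + _).
by apply: eq_bigr => p _; rewrite mulNr.
Qed.

HB.instance Definition _ S :=
  GRing.isZmodClosed.Build R (genideal S) (genideal_zmod_closed S).

Lemma genidealMl S a x : x \in genideal S -> a * x \in genideal S.
Proof.
move=> /genidealP[s [Ss ->]]; apply/genidealP.
exists [seq (a * p.1, p.2) | p <- s]; split=> [p /mapP[q /Ss Sq ->] //|].
by rewrite big_map mulr_sumr; apply: eq_bigr => p _; rewrite mulrA.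
Qed.

End GeneratedIdeal.

(* The ring quotients of ring_quotient are restricted to proper ideals of
   nontrivial rings. Here the quotient may be the zero ring, so only its
   additive group is taken from there. *)
Section GeneratedIdealQuotient.
Variables (R : comPzRingType) (S : set R).

Definition genideal_quot : Type := Quotient.quot (genideal S).
Local Notation Q := genideal_quot.

HB.instance Definition _ := ZmodQuotient.on Q.

Definition genideal_quot_one : Q := lift_cst Q 1.
Definition genideal_quot_mul : Q -> Q -> Q := lift_op2 Q *%R.

Canonical pi_genideal_quot_one := PiConst genideal_quot_one.

Lemma pi_genideal_quot_mul :
  {morph \pi_Q : x y / x * y >-> genideal_quot_mul x y}.
Proof.
move=> x y; unlock genideal_quot_mul; apply/eqP; rewrite piE Quotient.equivE.
rewrite -[_ * _](addrNK (x * repr (\pi_Q y))) -mulrBr -addrA -mulrBl.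
rewrite rpredD //.
  by rewrite genidealMl // Quotient.idealrBE reprK.
by rewrite mulrC genidealMl // Quotient.idealrBE reprK.
Qed.
Canonical pi_genideal_quot_mul_morph := PiMorph2 pi_genideal_quot_mul.

Lemma genideal_quot_mulA : associative genideal_quot_mul.
Proof. by move=> x y z; rewrite -[x]reprK -[y]reprK -[z]reprK !piE mulrA. Qed.

Lemma genideal_quot_mulC : commutative genideal_quot_mul.
Proof. by move=> x y; rewrite -[x]reprK -[y]reprK !piE mulrC. Qed.

Lemma genideal_quot_mul1 : left_id genideal_quot_one genideal_quot_mul.
Proof. by move=> x; rewrite -[x]reprK !piE mul1r. Qed.

Lemma genideal_quot_mulDl : left_distributive genideal_quot_mul +%R.
Proof.
move=> x y z; rewrite -[x]reprK -[y]reprK -[z]reprK.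
by rewrite -raddfD -!pi_genideal_quot_mul -raddfD mulrDl.
Qed.

HB.instance Definition _ := GRing.Zmodule_isComPzRing.Build Q
  genideal_quot_mulA genideal_quot_mulC genideal_quot_mul1 genideal_quot_mulDl.

End GeneratedIdealQuotient.

Definition regular_sequence (R : comPzRingType) (d : Order.disp_t)
    (I : orderType d) (f : I -> R) : Prop :=
  (1 : genideal_quot (range f)) != 0 /\
  forall a : I,
    GRing.lreg (\pi_(genideal_quot [set f b | b in [set b | (b < a)%O]]) (f a)).

Definition fr_condition (R : comPzRingType) (d : Order.disp_t)
    (I : orderType d) (f : I -> R) : Prop :=
  forall (r : nat) (s : 'I_r -> I),
    {homo s : i j / (i < j)%O} -> regular_sequence (f \o s).

(* R is the internal direct sum of the additive subgroups A n.  That 1 lies in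
   A 0 follows. *)
Definition nat_grading (R : comPzRingType) (A : nat -> zmodClosed R) : Prop :=
  [/\ forall x : R, exists (n : nat) (c : nat -> R),
        (forall i, c i \in A i) /\ x = \sum_(i < n) c i,
      forall (n : nat) (c : nat -> R), (forall i, c i \in A i) ->
        \sum_(i < n) c i = 0 -> forall i, (i < n)%N -> c i = 0 &
      forall (m n : nat) (x y : R),
        x \in A m -> y \in A n -> x * y \in A (m + n)%N].

(* 0 is homogeneous of every degree. *)
Definition homogeneous_pos (R : comPzRingType) (A : nat -> zmodClosed R)
    (x : R) : Prop :=
  exists2 n : nat, (0 < n)%N & x \in A n.

(* Main.v *)
Require Import Defs.
From HB Require Import structures.
From mathcomp Require Import all_boot all_order all_algebra.
From mathcomp Require Import boolp classical_sets wochoice.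

Set Implicit Arguments.
Unset Strict Implicit.
Unset Printing Implicit Defensive.

Import Order.TTheory GRing.Theory.

Local Open Scope classical_set_scope.
Local Open Scope ring_scope.
Local Open Scope quotient_scope.

(** Call a family independent on a set U of indices when f a is a nonzerodivisor
    modulo the ideal generated by f @` T for every T included in U and every a
    in U outside T. This does not mention the order of the indices. An
    independent family generating a proper ideal is therefore a regular sequence
    for any order on its indices, and so is each of its subfamilies. The theorem
    comes down to showing that a regular sequence of homogeneous elements of
    positive degree is independent (regular_sequence_independent). Conversely,
    the FR-condition gives regularity because a relation modulo the predecessors
    of a involves only finitely many of them, so it is already a relation for
    some finite increasing sequence ending at a (fr_condition_regular_sequence).

    Independence is proved by transfinite induction, adding one index g at a
    time. By the finiteness of relations, it passes to unions of chains
    (independent_chain), so only the step from U to g |` U matters, where f g is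
    a nonzerodivisor modulo the whole ideal of U. Two things are needed.

    - Descent (independent_regular_mod): f g remains a nonzerodivisor modulo the
      smaller ideal of any T included in U. Suppose that x is homogeneous and
      that f g * x lies in the ideal of T. Then x lies in the ideal of U, hence
      in that of T and finitely many further indices, which are removed one by
      one. To remove b, let J be the ideal of T and the remaining indices, so
      that x = f b * y modulo J. As f b is a nonzerodivisor modulo J by the
      independence on U, f g * y lies in J as well. Now y is homogeneous of
      degree less than x, since f b has positive degree, so y and then x lie in
      J by induction on the degree.

    - Exchange (regular_mod_swap): if a is a nonzerodivisor modulo J and c is
      one modulo J + (a), then a is one modulo J + (c). This treats the older
      indices once g is among the generators. *)

(** * Generated ideals *)

Section Ideals.
Context {R : comPzRingType}.
Implicit Types (S T : set R) (a c x y : R).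

Lemma mem_genideal S x : S x -> x \in genideal S.
Proof.
move=> Sx; apply/genidealP; exists [:: (1, x)]; split=> [p|].
  by rewrite inE => /eqP ->.
by rewrite big_seq1 mul1r.
Qed.

Lemma genidealMr S a x : a \in genideal S -> a * x \in genideal S.
Proof. by rewrite mulrC; apply: genidealMl. Qed.

Lemma genideal_ind S (P : R -> Prop) :
    P 0 -> (forall x y, P x -> P y -> P (x + y)) ->
    (forall x a, S a -> P (x * a)) ->
  forall x, x \in genideal S -> P x.
Proof.
move=> P0 PD PM x /genidealP[s [Ss ->]].
elim: s Ss => [|p s IHs] Ss; first by rewrite big_nil.
rewrite big_cons; apply: PD; first by apply/PM/Ss; rewrite mem_head.
by apply: IHs => q qs; apply: Ss; rewrite inE qs orbT.
Qed.

Lemma genideal_subset S T x :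
  S `<=` T -> x \in genideal S -> x \in genideal T.
Proof.
move=> ST; elim/genideal_ind=> [|y z|y a /ST Ta]; first exact: rpred0.
  exact: rpredD.
exact/genidealMl/mem_genideal.
Qed.

Lemma genidealU1P S a x :
  x \in genideal (a |` S) <-> exists y, x - a * y \in genideal S.
Proof.
split=> [|[y Sxy]].
  elim/genideal_ind=> [|y z [y' Sy] [z' Sz]|y b [->|Sb]].
  - by exists 0; rewrite mulr0 subr0 rpred0.
  - by exists (y' + z'); rewrite mulrDr opprD addrACA rpredD.
  - by exists y; rewrite mulrC subrr rpred0.
  - by exists 0; rewrite mulr0 subr0; apply/genidealMl/mem_genideal.
rewrite -[x](subrK (a * y)) rpredD //.
  by apply: genideal_subset Sxy => z; right.
by apply/genidealMr/mem_genideal; left.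
Qed.

(** Membership in an ideal involves finitely many generators; every passage
    between finite and infinite families goes through this. *)
Lemma genideal_image_finite (I : choiceType) (f : I -> R) (T : set I) x :
  x \in genideal (f @` T) ->
  exists2 s : seq I, [set` s] `<=` T & x \in genideal (f @` [set` s]).
Proof.
elim/genideal_ind=> [|y z [s sT ys] [t tT zt]|y _ [b Tb <-]].
- by exists [::] => //; rewrite rpred0.
- exists (s ++ t) => [b|].
    by rewrite /= mem_cat => /orP[/sT|/tT].
  apply: rpredD; [move: ys|move: zt]; apply: genideal_subset;
    by apply: image_subset => b; rewrite /= mem_cat => ->; rewrite ?orbT.
- exists [:: b] => [c|]; first by rewrite /= inE => /eqP ->.
  by apply/genidealMl/mem_genideal; exists b; rewrite //= mem_head.
Qed.

Definition regular_mod S a :=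
  forall x, a * x \in genideal S -> x \in genideal S.

(** If a * x = c * y modulo S, then c kills y modulo S and a, so y = a * z and
    a kills x - c * z, which is thus zero modulo S. *)
Lemma regular_mod_swap S a c :
  regular_mod S a -> regular_mod (a |` S) c -> regular_mod (c |` S) a.
Proof.
move=> rega regc x /genidealU1P[y axcy]; apply/genidealU1P.
have /regc/genidealU1P[z yaz] : c * y \in genideal (a |` S).
  by apply/genidealU1P; exists x; rewrite -opprB rpredN.
exists z; apply: rega; rewrite mulrBr mulrCA.
by rewrite -(subrK (c * y) (a * x)) -addrA -mulrBr rpredD // genidealMl.
Qed.

Lemma genideal_quot_eq S x y :
  (\pi_(genideal_quot S) x == \pi_(genideal_quot S) y) = (x - y \in genideal S).
Proof. by rewrite Quotient.idealrBE. Qed.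

Lemma genideal_quot_nontrivial S :
  ((1 : genideal_quot S) != 0) = (1 \notin genideal S).
Proof.
have -> : (1 : genideal_quot S) = \pi_(genideal_quot S) 1.
  by rewrite -[LHS]/(genideal_quot_one S) piE.
have -> : (0 : genideal_quot S) = \pi_(genideal_quot S) 0 by rewrite raddf0.
by rewrite genideal_quot_eq subr0.
Qed.

Lemma lreg_genideal_quot S a :
  GRing.lreg (\pi_(genideal_quot S) a) <-> regular_mod S a.
Proof.
have piM x y : \pi_(genideal_quot S) x * \pi y = \pi_(genideal_quot S) (x * y).
  exact/esym/pi_genideal_quot_mul.
split=> [lrega x ax|rega u v].
  rewrite -[x]subr0 -genideal_quot_eq; apply/eqP/lrega.
  by apply/eqP; rewrite !piM genideal_quot_eq -mulrBr subr0.
rewrite -[u]reprK -[v]reprK !piM => /eqP; rewrite genideal_quot_eq -mulrBr.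
by move=> /rega; rewrite -genideal_quot_eq => /eqP.
Qed.

Lemma regular_sequenceP (d : Order.disp_t) (I : orderType d) (f : I -> R) :
  regular_sequence f <->
  1 \notin genideal (range f) /\
  forall a : I, regular_mod (f @` [set b | (b < a)%O]) (f a).
Proof.
rewrite /regular_sequence genideal_quot_nontrivial.
by split=> -[f1 freg]; split=> // a; apply/lreg_genideal_quot.
Qed.

End Ideals.

(** * Homogeneous components *)

Section Grading.
Context {R : comPzRingType} {A : nat -> zmodClosed R}.
Hypothesis gradA : nat_grading A.
Implicit Types (S : set R) (a c x y : R) (u v : nat -> R).

(** The support of u is bounded explicitly, which makes u determined by x
    at every index. *)
Definition decomposition x u :=
  (forall n, u n \in A n) /\
  exists N, (forall n, (N <= n)%N -> u n = 0) /\ x = \sum_(i < N) u i.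

Lemma big_ord_pad u N M : (N <= M)%N -> (forall n, (N <= n)%N -> u n = 0) ->
  \sum_(i < N) u i = \sum_(i < M) u i.
Proof.
move=> NM u0; rewrite -!(big_mkord xpredT u) (big_cat_nat (leq0n N) NM) /=.
rewrite [X in _ = _ + X]big_nat_cond [X in _ = _ + X]big1 ?addr0 //.
by move=> i /andP[/andP[/u0]].
Qed.

Lemma decomposition_exists x : exists u, decomposition x u.
Proof.
have [dec _ _] := gradA; have [N [u [uA ->]]] := dec x.
exists (fun n => if (n < N)%N then u n else 0); split=> [n|].
  by case: ifP => // _; apply: rpred0.
exists N; split=> [n|]; first by rewrite ltnNge => ->.
by apply: eq_bigr => i _; rewrite ltn_ord.
Qed.

Lemma decompositionB x y u v : decomposition x u -> decomposition y v ->
  decomposition (x - y) (fun n => u n - v n).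
Proof.
move=> [uA [N [uN ->]]] [vA [M [vM ->]]]; split=> [n|]; first exact: rpredB.
exists (maxn N M); split=> [n|].
  by rewrite geq_max => /andP[/uN -> /vM ->]; rewrite subr0.
rewrite (big_ord_pad (leq_maxl N M) uN) (big_ord_pad (leq_maxr N M) vM).
by rewrite sumrB.
Qed.

Lemma decomposition0_eq0 u : decomposition 0 u -> forall n, u n = 0.
Proof.
move=> [uA [N [uN s0]]] n; have [/uN //|nN] := leqP N n.
by have [_ uniq _] := gradA; apply: uniq uA _ n nN.
Qed.

Lemma decomposition_unique x u v :
  decomposition x u -> decomposition x v -> u =1 v.
Proof.
move=> xu xv n; apply/eqP; rewrite -subr_eq0; apply/eqP.
apply: (@decomposition0_eq0 (fun n => u n - v n)).
by rewrite -(subrr x); apply: decompositionB.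
Qed.

Definition hpart x : nat -> R := projT1 (cid (decomposition_exists x)).

Lemma hpartP x : decomposition x (hpart x).
Proof. by rewrite /hpart; case: cid. Qed.

Lemma hpart_mem x n : hpart x n \in A n.
Proof. by have [] := hpartP x. Qed.

Lemma hpartB x y n : hpart (x - y) n = hpart x n - hpart y n.
Proof.
by apply: (decomposition_unique (hpartP _) (decompositionB _ _)); apply: hpartP.
Qed.

Lemma hpart0 n : hpart 0 n = 0.
Proof. by rewrite -[X in hpart X](subrr 0) hpartB subrr. Qed.

Lemma hpartD x y n : hpart (x + y) n = hpart x n + hpart y n.
Proof. by rewrite -[y in LHS]opprK -[- y]sub0r !hpartB hpart0 sub0r opprK. Qed.

Lemma hpart_homogeneous x n : x \in A n -> hpart x n = x.
Proof.
move=> xA; pose u i := if i == n then x else 0.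
have xu : decomposition x u.
  split=> [i|]; first by rewrite /u; case: eqP => [->//|_]; apply: rpred0.
  exists n.+1; split=> [i ni|]; first by rewrite /u gtn_eqF.
  rewrite big_ord_recr /= big1 ?add0r /u ?eqxx // => i _.
  by rewrite ltn_eqF.
by rewrite (decomposition_unique (hpartP x) xu) /u eqxx.
Qed.

Lemma hpartM a x m n : a \in A m ->
  hpart (a * x) n = if (m <= n)%N then a * hpart x (n - m) else 0.
Proof.
move=> aA; have [_ _ AM] := gradA; have [xA [N [xN xE]]] := hpartP x.
pose u i := if (m <= i)%N then a * hpart x (i - m) else 0.
suff axu : decomposition (a * x) u.
  exact: decomposition_unique (hpartP _) axu n.
rewrite /u; split=> [i|].
  by case: leqP => [mi|_]; [rewrite -[i in A i](subnKC mi) AM|apply: rpred0].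
exists (m + N)%N; split=> [i mNi|].
  by case: leqP => // mi; rewrite xN ?mulr0 // leq_subRL.
rewrite big_split_ord /= big1 => [|i _]; last by rewrite leqNgt ltn_ord.
rewrite add0r {1}xE mulr_sumr; apply: eq_bigr => i _.
by rewrite leq_addr addKn.
Qed.

Definition homogeneous_set S := forall a, S a -> exists m, a \in A m.

Lemma hpart_genideal S x n :
  homogeneous_set S -> x \in genideal S -> hpart x n \in genideal S.
Proof.
move=> homS; move: x; apply: genideal_ind => [|y z Sy Sz|y a Sa].
- by rewrite hpart0 rpred0.
- by rewrite hpartD rpredD.
have [m aA] := homS a Sa; rewrite mulrC (hpartM _ _ aA).
by case: ifP => _; [apply/genidealMr/mem_genideal|apply: rpred0].
Qed.

(** The components of a * x are the a * hpart x n, and an ideal with homogeneous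
    generators contains the components of its members; testing regularity on
    homogeneous elements is thus enough. *)
Lemma regular_mod_homogeneous S a m : homogeneous_set S -> a \in A m ->
  (forall n x, x \in A n -> a * x \in genideal S -> x \in genideal S) ->
  regular_mod S a.
Proof.
move=> homS aA rega x axS; have [xA [N [_ ->]]] := hpartP x.
apply: rpred_sum => i _; apply: rega (xA i) _.
have := hpart_genideal (m + i) homS axS.
by rewrite (hpartM _ _ aA) leq_addr addKn.
Qed.

(** The coefficient of a may be taken homogeneous of the complementary degree k.
    The first alternative arises when n < m, where that coefficient is zero. *)
Lemma homogeneous_genidealU1 S a m x n : homogeneous_set S ->
    a \in A m -> x \in A n -> x \in genideal (a |` S) ->
  x \in genideal S \/
  exists k y, [/\ (m + k)%N = n, y \in A k & x - a * y \in genideal S].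
Proof.
move=> homS aA xA /genidealU1P[y Sxy].
have := hpart_genideal n homS Sxy.
rewrite hpartB (hpart_homogeneous xA) (hpartM _ _ aA).
case: leqP => [mn|_] Sx; last by left; rewrite subr0 in Sx.
right; exists (n - m)%N, (hpart y (n - m)).
by split; rewrite ?subnKC ?hpart_mem.
Qed.

End Grading.

(** * Independent families *)

Section Independence.
Context {R : comPzRingType} {I : choiceType}.
Implicit Types (f : I -> R) (T U V : set I).

Definition independent f U :=
  forall T a, T `<=` U -> U a -> ~ T a -> regular_mod (f @` T) (f a).

Lemma sub_independent f U V : V `<=` U -> independent f U -> independent f V.
Proof.
move=> VU indU T a TV /VU Ua; apply: indU => //.
exact: subset_trans VU.
Qed.

Lemma independent_finitary f U :
  (forall s : seq I, [set` s] `<=` U -> independent f [set` s]) ->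
  independent f U.
Proof.
move=> indf T a TU Ua nTa x /genideal_image_finite[s sT axs].
apply: (@genideal_subset _ (f @` [set` s])); first exact: image_subset.
apply: (indf (a :: s)) axs => [b|b sb||/sT //].
- by rewrite /= inE => /orP[/eqP ->//|/sT/TU].
- by rewrite /= inE sb orbT.
- by rewrite /= mem_head.
Qed.

Context {A : nat -> zmodClosed R}.
Hypothesis gradA : nat_grading A.

(** Regularity descends to smaller ideals because degrees are bounded below. The
    induction on the degree n of x is for all T at once, as its hypothesis is
    applied to the intermediate sets V between T and U. *)
Lemma independent_regular_mod f U T c m :
    (forall a, homogeneous_pos A (f a)) -> independent f U ->
    c \in A m -> regular_mod (f @` U) c -> T `<=` U ->
  regular_mod (f @` T) c.
Proof.
move=> homf indU cA regc TU.
have homT V : homogeneous_set (A := A) (f @` V).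
  by move=> _ [b _ <-]; have [k _ fbA] := homf b; exists k.
apply: (regular_mod_homogeneous gradA (homT T) cA) => n.
have [N] := ubnP n; elim: N n T TU => // N IHN n T TU nN x xA cxT.
have [s sU xs] : exists2 s : seq I,
    [set` s] `<=` U & x \in genideal (f @` ([set` s] `|` T)).
  have /regc/genideal_image_finite[s sU xs] : c * x \in genideal (f @` U).
    exact: genideal_subset (image_subset TU) cxT.
  by exists s => //; apply: genideal_subset xs; apply: image_subset => b; left.
(* Once s is exhausted, x lies in the ideal of T itself. *)
elim: s sU xs => [|g s IHs] sU xgs; first by move: xgs; rewrite set_nil set0U.
have sU' : [set` s] `<=` U by move=> b sb; apply: sU; rewrite /= inE sb orbT.
apply: IHs => //; set V := [set` s] `|` T.
have VU : V `<=` U by rewrite subUset.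
have gV : [set` g :: s] `|` T = g |` V.
  rewrite /V setUA; congr (_ `|` _).
  by apply/seteqP; split=> b /=; rewrite inE => /predU1P.
have [Vg|nVg] := pselect (V g).
  by move: xgs; rewrite gV setUidr // => _ ->.
rewrite gV image_setU image_set1 in xgs.
have [k k_gt0 gA] := homf g.
have [//|[l [y [kl yA xgy]]]] :=
  homogeneous_genidealU1 gradA (homT V) gA xA xgs.
rewrite -[x](subrK (f g * y)) rpredD ?genidealMl //.
(* Here l < n because f g has positive degree k. *)
apply: (IHN l) => //.
  by rewrite -ltnS (leq_trans _ nN) // -kl ltnS -add1n leq_add2r.
(* f g * (c * y) = c * x - c * (x - f g * y), and f g is regular modulo V. *)
apply: (indU V g) => //; first by apply: sU; rewrite /= mem_head.
rewrite mulrCA -(subKr x (f g * y)) mulrBr.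
apply: rpredB; last exact: genidealMl.
by apply: genideal_subset cxT; apply: image_subset; right.
Qed.

(** When g belongs to T, regularity of an older f a modulo f @` T comes from
    exchanging f a with f g over T `\ g, the descent giving regularity of f g
    modulo a |` T `\ g. *)
Lemma independent_setU1 f U g :
    (forall a, homogeneous_pos A (f a)) -> independent f U ->
    regular_mod (f @` U) (f g) -> independent f (g |` U).
Proof.
move=> homf indU regg.
have subg T : T `<=` U -> regular_mod (f @` T) (f g).
  by have [k _ gA] := homf g; apply: independent_regular_mod gA regg.
have delg T : T `<=` g |` U -> ~ T g -> T `<=` U.
  by move=> TgU nTg b Tb; have [bg|//] := TgU b Tb; rewrite -bg in nTg.
move=> T a TgU gUa nTa; have [ag|nag] := pselect (a = g).
  by rewrite ag in nTa *; apply/subg/delg.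
have Ua : U a by case: gUa.
have [Tg|nTg] := pselect (T g); last by apply: indU => //; apply: delg.
have T'U : T `\ g `<=` U by move=> b [/TgU[|//] bg] /(_ bg).
rewrite -(setD1K Tg) image_setU image_set1.
apply: regular_mod_swap; first by apply: indU => // -[].
rewrite -image_set1 -image_setU; apply: subg => b [->//|/T'U //].
Qed.

End Independence.

(** * Regular sequences over well-ordered sets *)

Section WellOrder.
Context {R : comPzRingType} {A : nat -> zmodClosed R}.
Hypothesis gradA : nat_grading A.
Context {d : Order.disp_t} {I : orderType d}.

Lemma well_order_ind (P : I -> Prop) : well_order (<=%O : rel I) ->
  (forall a, (forall b, (b < a)%O -> P b) -> P a) -> forall a, P a.
Proof.
move=> wo IH a; apply: contrapT => nPa.
have [|z [[/asboolP nPz zmin] _]] := wo (fun b => `[< ~ P b >]).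
  by exists a; apply/asboolP.
apply: nPz; apply: IH => b bz; apply: contrapT => nPb.
by have := zmin b (asboolT nPb); rewrite leNgt bz.
Qed.

Lemma seq_upper_bound (s : seq I) (a : I) : a \in s ->
  exists2 m, m \in s & forall b, b \in s -> (b <= m)%O.
Proof.
elim: s a => // c s IHs a _.
case: s IHs => [_|e s /(_ e (mem_head _ _))[m ms mub]].
  by exists c; rewrite ?mem_head // => b; rewrite inE => /eqP ->.
exists (Order.max c m).
  by case: leP => _; rewrite ?mem_head // inE ms orbT.
by move=> b; rewrite inE le_max => /orP[/eqP ->|/mub ->]; rewrite ?lexx ?orbT.
Qed.

(** A finite subset of U lies below its maximum, so independence on the initial
    segments is enough. It serves both at limit stages and to conclude. *)
Lemma independent_chain (f : I -> R) (U : set I) :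
  (forall a, U a -> independent f [set b | (b <= a)%O]) -> independent f U.
Proof.
move=> indf; apply: independent_finitary => -[|e s] sU.
  by move=> T a _; rewrite set_nil.
have [m ms mub] := seq_upper_bound (mem_head e s).
exact: (sub_independent mub (indf m (sU m ms))).
Qed.

Lemma regular_sequence_independent (f : I -> R) :
    well_order (<=%O : rel I) -> (forall a, homogeneous_pos A (f a)) ->
  regular_sequence f -> independent f setT.
Proof.
move=> wo homf /regular_sequenceP[_ regf].
apply: independent_chain => a _; move: a; apply: (well_order_ind wo) => a IHa.
have -> : [set b | (b <= a)%O] = a |` [set b | (b < a)%O].
  by apply/seteqP; split=> b /=; rewrite le_eqVlt => /predU1P.
by apply: (independent_setU1 gradA) => //; apply: independent_chain.
Qed.

End WellOrder.

(** Independence is insensitive to the order of the indices. Injections sigma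
    cover at once the finite subsequences and the permutations of f. *)
Lemma independent_regular_sequence (R : comPzRingType) (I : choiceType)
    (f : I -> R) (d : Order.disp_t) (J : orderType d) (sigma : J -> I) :
    independent f setT -> 1 \notin genideal (range f) -> injective sigma ->
  regular_sequence (f \o sigma).
Proof.
move=> indf f1 injs; apply/regular_sequenceP; split=> [|a].
  apply: contra f1; apply: genideal_subset => _ [j _ <-]; exact: imageT.
rewrite -image_comp; apply: indf => // -[b ba /injs ab].
by rewrite -ab /= ltxx in ba.
Qed.

Lemma increasing_enumeration (d : Order.disp_t) (I : orderType d) (s : seq I) :
  exists (r : nat) (t : 'I_r -> I),
    {homo t : i j / (i < j)%O} /\ (forall b, b \in s -> exists i, b = t i).
Proof.
exists _, (tnth (in_tuple (sort <=%O (undup s)))); split=> [i j ij|b sb].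
  have b0 := tnth (in_tuple _) i; rewrite !(tnth_nth b0) /=.
  by rewrite lt_sorted_ltn_nth ?inE ?ltn_ord ?sort_lt_sorted ?undup_uniq.
by apply/tnthP; rewrite mem_sort mem_undup.
Qed.

(** Both a representation of 1 and a relation modulo the predecessors of a live
    on finitely many indices; listed increasingly, together with a in the second
    case, these form one of the finite subsequences of the FR-condition. *)
Lemma fr_condition_regular_sequence (R : comPzRingType) (d : Order.disp_t)
    (I : orderType d) (f : I -> R) : fr_condition f -> regular_sequence f.
Proof.
move=> frf; apply/regular_sequenceP; split=> [|a x].
  apply/negP => /genideal_image_finite[s _]; apply/negP.
  have [r [t [t_mono t_surj]]] := increasing_enumeration s.
  have /regular_sequenceP[+ _] := frf r t t_mono.
  apply: contra; apply: genideal_subset => _ [b /t_surj[i ->] <-].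
  by exists i.
move=> /genideal_image_finite[s sa axs].
have [r [t [t_mono t_surj]]] := increasing_enumeration (a :: s).
have [i ai] := t_surj a (mem_head a s); rewrite {}ai in sa axs *.
have /regular_sequenceP[_ /(_ i x) regt] := frf r t t_mono.
rewrite /= -image_comp in regt.
apply: genideal_subset (regt _).
  by apply: image_subset => _ [j /t_mono + <-].
apply: genideal_subset axs; apply: image_subset => b sb.
(* Since t is increasing, b = t j < t i forces j < i. *)
have [|j bj] := t_surj b; first by rewrite inE (sb : b \in s) orbT.
exists j => //=; have := sa b sb; rewrite /= bj.
apply: contraTT; rewrite -!leNgt le_eqVlt.
by move=> /predU1P[->//|/t_mono/ltW].
Qed.

Theorem theorem1p22
    (R : comPzRingType) (A : nat -> zmodClosed R) (gradA : nat_grading A)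
    (d : Order.disp_t) (Omega : orderType d)
    (woOmega : well_order (<=%O : rel Omega))
    (f : Omega -> R) (homf : forall a : Omega, homogeneous_pos A (f a)) :
  (regular_sequence f <-> fr_condition f) /\
  (regular_sequence f ->
   forall (d' : Order.disp_t) (Omega' : orderType d'),
     well_order (<=%O : rel Omega') ->
     forall sigma : Omega' -> Omega,
       bijective sigma -> regular_sequence (f \o sigma)).
Proof.
have regular_reindex d' (J : orderType d') (sigma : J -> Omega) :
    regular_sequence f -> injective sigma -> regular_sequence (f \o sigma).
  move=> freg; apply: independent_regular_sequence.
    exact: (regular_sequence_independent gradA).
  by case/regular_sequenceP: freg.
split; last by move=> freg d' Omega' _ sigma /bij_inj; apply: regular_reindex.
split; last exact: fr_condition_regular_sequence.
by move=> freg r s s_mono; apply: regular_reindex => //; exact/inc_inj/le_mono.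
Qed.
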